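(* For every prime $p\ge3$, $R^{\mathrm{pub}}_{1/20}(\textsc{Inverse}_n)=\Omega(n^2\log p)$.
   Context: $\textsc{Inverse}_n$: Alice holds $x\in M_n(\mathbb{F}_p)$, Bob holds $y\in M_n(\mathbb{F}_p)$, with the promise that $x+y$ is invertible over $\mathbb{F}_p$; they must determine whether the top-left entry of $(x+y)^{-1}$ is zero. $R^{\mathrm{pub}}_\delta$ is the $\delta$-error public-coin randomized two-player communication complexity (correct with probability $\ge1-\delta$ on every promise input; cost = worst-case bits communicated). *)

(* Defs.v *)
From HB Require Import structures.
From mathcomp Require Import all_boot all_order all_algebra.
From mathcomp Require Import all_classical all_reals all_analysis.

Set Implicit Arguments.
Unset Strict Implicit.
Unset Printing Implicit Defensive.

Import Order.TTheory GRing.Theory Num.Theory.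

Local Open Scope ring_scope.

(* Deterministic two-player protocol trees. At an internal node the named
   player sends one bit, computed from that player's own input; the bit
   [false] leads to the first subtree and [true] to the second. *)
Inductive protocol (X Y : Type) : Type :=
| Output of bool
| Alice of (X -> bool) & protocol X Y & protocol X Y
| Bob of (Y -> bool) & protocol X Y & protocol X Y.

Fixpoint run (X Y : Type) (t : protocol X Y) (x : X) (y : Y) : bool :=
  match t with
  | Output b => b
  | Alice a t0 t1 => if a x then run t1 x y else run t0 x y
  | Bob a t0 t1 => if a y then run t1 x y else run t0 x y
  end.

Fixpoint height (X Y : Type) (t : protocol X Y) : nat :=
  match t with
  | Output _ => 0
  | Alice _ t0 t1 => (maxn (height t0) (height t1)).+1
  | Bob _ t0 t1 => (maxn (height t0) (height t1)).+1
  end.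

(* A public-coin protocol is a probability distribution over deterministic
   protocols. Since the inputs range over finite types, only finitely many
   functions are computed by protocols of a given height, so a finite space of
   coin outcomes with arbitrary weights loses no generality. *)
Record public_coin (R : realType) (X Y : finType) := PublicCoin {
  coin : finType;
  weight : coin -> R;
  weight_ge0 : forall w, 0 <= weight w;
  weight_sum1 : \sum_w weight w = 1;
  strategy : coin -> protocol X Y
}.

Definition cost (R : realType) (X Y : finType) (P : public_coin R X Y) : nat :=
  \max_(w : coin P) height (strategy w).

(* A promise problem is a partial Boolean function: [None] means that the
   promise is violated, in which case nothing is required of the protocol. *)
Definition computes (R : realType) (X Y : finType) (delta : R)
    (f : X -> Y -> option bool) (P : public_coin R X Y) : Prop :=
  forall x y b, f x y = Some b ->
    1 - delta <= \sum_(w : coin P | run (strategy w) x y == b) weight w.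

Definition Rpub (R : realType) (X Y : finType) (delta : R)
    (f : X -> Y -> option bool) : \bar R :=
  ereal_inf [set (c%:R)%:E | c in [set c : nat |
    exists P : public_coin R X Y, computes delta f P /\ cost P = c]]%classic.

(* The problem for square matrices of size m = n.+1 (so that there is a
   top-left entry). *)
Definition Inverse (p n : nat) (x y : 'M['F_p]_n.+1) : option bool :=
  if x + y \in unitmx then Some (invmx (x + y) ord0 ord0 == 0) else None.

(* Main.v *)
(* Write q for the order of the field and restrict the inputs to matrices
   M = [0 1 0; 1 a u; 0 v w], where W = [a u; v w] is additively shared. If w is
   invertible then so is M, and the top-left entry of M^-1 is
   - (a - u w^-1 v), so a protocol must distinguish a = u w^-1 v from
   a = u w^-1 v + 1.

   Let Phi be the Fourier transform of the indicator of GL_k. On every rectangle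
   its sum over x + y is tiny, by Cauchy-Schwarz. Moreover Phi (W) depends only
   on the corank d of W and is proportional to prod_(i <= d) (1 - q^i): the sum
   of Phi over all rank-one updates of W with a fixed row vector vanishes. The
   witness is psi (W) = Phi (W) - Phi (W - E_00), with E_00 the matrix unit.
   It vanishes unless u and v lie in the row and column space of w and the
   Schur complement of w is 0 or 1; there its sign is determined by the Schur
   complement and the corank of w. The part of |psi| carried by singular w, on
   which the protocol may answer anything, is at most 4/7 of the part carried by
   invertible w as soon as q >= 3: passing from corank d to corank d + 1 of w
   divides it by at least q^(d + 1) - 1. As 4/7 < 9/10, a protocol with error
   1/20 correlates with psi, hence has p^(Omega (n^2)) leaves. *)

Require Import Defs.
From HB Require Import structures.
From mathcomp Require Import all_boot all_order all_algebra.
From mathcomp Require Import mxabelem ring lra zify.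
From mathcomp Require Import all_classical all_reals all_analysis.

Set Implicit Arguments.
Unset Strict Implicit.
Unset Printing Implicit Defensive.

Import Order.TTheory GRing.Theory Num.Theory.

Local Open Scope ring_scope.

(** * Fourier transform of the general linear group *)

(** Averaging over the translations [tau c] replaces [f v] by [f v + c], which for fixed [v] runs
    once through all of [F]. *)
Lemma sum_equidistributed (R : realFieldType) (V F : finZmodType) (f : V -> F)
    (tau : F -> V) (g : F -> R) :
  (forall v c, f (v + tau c) = f v + c) ->
  #|F|%:R * (\sum_v g (f v)) = #|V|%:R * \sum_c g c.
Proof.
move=> ftau.
have -> : #|F|%:R * (\sum_v g (f v)) = \sum_(c : F) \sum_v g (f v + c).
  rewrite mulr_natl -sumr_const.
  apply: eq_bigr => c _; rewrite (reindex_inj (addIr (tau c))) /=.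
  by apply: eq_bigr => v _; rewrite ftau.
rewrite exchange_big /= mulr_natl -sumr_const; apply: eq_bigr => v _.
by rewrite [RHS](reindex_inj (addrI (f v))).
Qed.

Definition theta (R : realFieldType) (F : finFieldType) (a : F) : R :=
  #|F|%:R * (a == 0)%:R - 1.

Lemma sumr_indicator (R : realFieldType) (F : finType) (b : F) (g : F -> R) :
  \sum_a (b == a)%:R * g a = g b.
Proof.
rewrite (bigD1 b) //= eqxx mul1r big1 ?addr0 // => a; rewrite eq_sym.
by move/negPf->; rewrite mul0r.
Qed.

Lemma card_field_gt1 (R : realFieldType) (F : finFieldType) :
  1 < #|F|%:R :> R.
Proof. by rewrite ltr1n card_finNzRing_gt1. Qed.

Lemma sum_theta (R : realFieldType) (F : finFieldType) :
  \sum_(a : F) theta R a = 0.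
Proof.
rewrite /theta big_split /= -mulr_sumr sumr_const.
under eq_bigr => a _ do rewrite eq_sym -[(_ == _)%:R]mulr1.
by rewrite (sumr_indicator 0 (fun=> 1)) mulr1 mulNrn subrr.
Qed.

Lemma sum_theta_equidistributed (R : realFieldType) (F : finFieldType)
    (V : finZmodType) (f : V -> F) (tau : F -> V) :
  (forall v c, f (v + tau c) = f v + c) -> \sum_v theta R (f v) = 0.
Proof.
move=> ftau; have := sum_equidistributed (theta R (F := F)) ftau.
rewrite sum_theta mulr0 => /eqP; rewrite mulf_eq0 gt_eqF /=; first by move/eqP.
by apply: lt_trans (card_field_gt1 R F).
Qed.

Lemma card_equidistributed (F : finFieldType)
    (V : finZmodType) (f : V -> F) (tau : F -> V) (b : F) :
  (forall v c, f (v + tau c) = f v + c) -> (#|F| * #|[pred v | f v == b]| =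
    #|V|)%N.
Proof.
move=> ftau; apply/eqP; rewrite -(eqr_nat rat) natrM.
have := sum_equidistributed (fun a => (b == a)%:R * 1 : rat) ftau.
rewrite (sumr_indicator b (fun=> 1)) mulr1 => <-.
apply/eqP; congr (_ * _).
rewrite -sum1_card natr_sum big_mkcond /=; apply: eq_bigr => v _.
by rewrite inE eq_sym mulr1; case: eqP.
Qed.

(** A Gram representation by centred indicator vectors of [a] and [b]. It produces real sums of
    squares where characters would produce squared moduli. *)
Lemma theta_gram (R : realFieldType) (F : finFieldType) (a b : F) :
  theta R (a - b) = #|F|%:R *
    \sum_j ((a == j)%:R - #|F|%:R^-1) * ((b == j)%:R - #|F|%:R^-1).
Proof.
have q0 : #|F|%:R != 0 :> R by rewrite gt_eqF // (lt_trans _ (card_field_gt1 R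
  F)).
set q := #|F|%:R; rewrite -/q in q0.
have -> : \sum_j ((a == j)%:R - q^-1) * ((b == j)%:R - q^-1) =
    (a == b)%:R - q^-1.
  have sq : \sum_(j : F) q^-1 = 1 by rewrite sumr_const -[LHS]mulr_natl mulfV.
  under eq_bigr => j _ do rewrite mulrBl.
  rewrite big_split /= (sumr_indicator a (fun j => (b == j)%:R - q^-1)) sumrN.
  rewrite -mulr_sumr big_split /= sumrN sq.
  under [in X in _ - _ * (X - _)]eq_bigr => j _ do rewrite -[(_ == _)%:R]mulr1.
  by rewrite (sumr_indicator b (fun=> 1)) subrr mulr0 subr0 eq_sym.
by rewrite /theta subr_eq0 mulrBr mulfV.
Qed.

Lemma mxtrace_mul_delta (F : finFieldType) k (z : 'M[F]_k) i j :
  \tr (delta_mx j i *m z) = z i j.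
Proof.
rewrite /mxtrace (bigD1 j) //= big1 ?addr0 => [|l /negPf lj].
  rewrite mxE (bigD1 i) //= big1 ?addr0 => [|l /negPf li]; rewrite mxE ?li
    ?andbF ?mul0r //.
  by rewrite !eqxx mul1r.
by rewrite mxE big1 // => m _; rewrite mxE lj mul0r.
Qed.

Lemma sum_theta_mxtrace (R : realFieldType) (F : finFieldType) k (z : 'M[F]_k) :
  \sum_s theta R (\tr (s *m z)) =
    (z == 0)%:R * (#|F|%:R - 1) * #|F|%:R ^+ (k * k).
Proof.
have [->|z0] := eqVneq z 0.
  under eq_bigr => s _ do rewrite mulmx0 mxtrace0 /theta eqxx mulr1.
  by rewrite sumr_const card_mx mul1r -natrX mulr_natr.
have /existsP[i /existsP[j zij]] : [exists i, exists j, z i j != 0].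
  apply: contraNT z0 => /existsPn z0; apply/eqP/matrixP => i j; rewrite mxE.
  by have /existsPn/(_ j) := z0 i; rewrite negbK => /eqP.
rewrite !mul0r.
(* A nonzero entry of [z] lets a multiple of one matrix unit move the trace by any prescribed
   [c]. *)
pose tau c := c / z i j *: delta_mx j i : 'M[F]_k.
apply: (sum_theta_equidistributed _ (tau := tau)) => s c.
by rewrite mulmxDl raddfD -scalemxAl /= mxtraceZ mxtrace_mul_delta divfK.
Qed.

(* A multiple of the Fourier transform of the indicator of GL_k: since
   [theta a] is the sum of chi (c a) over c != 0, and GL_k is stable under
   scaling, no complex characters are needed. *)
Definition Phi (R : realFieldType) (F : finFieldType) k (M : 'M[F]_k) : R :=
  \sum_(s in unitmx) theta R (\tr (s *m M)).

(** A form of Parseval's identity: after expanding the squares with [theta_gram], summing over [s]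
    leaves only the terms x = y by [sum_theta_mxtrace], and there [C x * C x] is at most 1. *)
Lemma sum_mxtrace_correlation_sqr_le (R : realFieldType) (F : finFieldType) k
    (C : 'M[F]_k -> R) : (forall x, `|C x| <= 1) ->
  #|F|%:R * (\sum_s \sum_j
    (\sum_x C x * ((\tr (s *m x) == j)%:R - #|F|%:R^-1)) ^+ 2) <=
  (#|F|%:R - 1) * #|F|%:R ^+ (k * k) * #|F|%:R ^+ (k * k).
Proof.
move=> C1; set q := #|F|%:R.
have -> : q * (\sum_s \sum_j
    (\sum_x C x * ((\tr (s *m x) == j)%:R - q^-1)) ^+ 2) =
    \sum_x \sum_y C x * C y * \sum_s theta R (\tr (s *m (x - y))).
  transitivity (\sum_s \sum_x \sum_y C x * C y * theta R (\tr (s *m (x - y)))).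
    rewrite mulr_sumr; apply: eq_bigr => s _.
    under [RHS]eq_bigr => x _ do under eq_bigr => y _ do
      rewrite mulmxBr raddfB /= theta_gram mulrCA.
    under [RHS]eq_bigr => x _ do rewrite -mulr_sumr.
    rewrite -mulr_sumr; congr (_ * _).
    under [RHS]eq_bigr => x _ do under eq_bigr => y _ do rewrite mulr_sumr.
    under [RHS]eq_bigr => x _ do rewrite exchange_big /=.
    rewrite [RHS]exchange_big; apply: eq_bigr => j _ /=.
    rewrite expr2 mulr_suml; apply: eq_bigr => x _.
    by rewrite mulr_sumr; apply: eq_bigr => y _; rewrite mulrACA.
  rewrite exchange_big; apply: eq_bigr => x _ /=.
  by rewrite exchange_big; apply: eq_bigr => y _ /=; rewrite mulr_sumr.
under eq_bigr => x _ do under eq_bigr => y _ do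
  rewrite sum_theta_mxtrace subr_eq0 -/q mulrC -2!mulrA.
under eq_bigr => x _ do rewrite (sumr_indicator x
  (fun y => (q - 1) * q ^+ (k * k) * (C x * C y))).
rewrite [leRHS](_ : _ = \sum_(x : 'M[F]_k) (q - 1) * q ^+ (k * k)); last first.
  by rewrite sumr_const card_mx -natrX mulr_natr.
have q1 : 1 < q by apply: card_field_gt1.
apply: ler_sum => x _; rewrite ler_piMr //.
  by rewrite mulr_ge0 ?exprn_ge0 //; lra.
by rewrite -expr2 -real_normK ?num_real // exprn_ile1.
Qed.

(* Cauchy-Schwarz bounds a bilinear form in [Phi (x + y)] by its flat Fourier
   transform. *)
Lemma Phi_bilinear_le (R : realFieldType) (F : finFieldType) k
    (A B : 'M[F]_k -> R) :
    (forall x, `|A x| <= 1) -> (forall y, `|B y| <= 1) ->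
  `|\sum_x \sum_y A x * B y * Phi R (x + y)| <=
    (#|F|%:R - 1) * #|F|%:R ^+ (k * k) * #|F|%:R ^+ (k * k).
Proof.
(* Reflecting [B] turns x + y into the difference x - y that [theta_gram] factors. *)
move=> A1 B1; set q := #|F|%:R; pose B' y := B (- y).
pose E (C : 'M[F]_k -> R) s j :=
  \sum_x C x * ((\tr (s *m x) == j)%:R - q^-1).
have -> : \sum_x \sum_y A x * B y * Phi R (x + y) =
    q * \sum_(s in unitmx) \sum_j E A s j * E B' s j.
  transitivity (\sum_(s in unitmx) \sum_x \sum_y
      A x * B' y * theta R (\tr (s *m (x - y)))).
    rewrite [RHS]exchange_big /=; apply: eq_bigr => x _.
    rewrite [RHS]exchange_big /= (reindex_inj oppr_inj) /=; apply: eq_bigr =>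
      y _.
    by rewrite mulr_sumr.
  rewrite mulr_sumr; apply: eq_bigr => s _.
  under [LHS]eq_bigr => x _ do under eq_bigr => y _ do
    rewrite mulmxBr raddfB /= theta_gram mulrCA.
  under [LHS]eq_bigr => x _ do rewrite -mulr_sumr.
  rewrite -mulr_sumr; congr (_ * _).
  under [LHS]eq_bigr => x _ do under eq_bigr => y _ do rewrite mulr_sumr.
  under [LHS]eq_bigr => x _ do rewrite exchange_big /=.
  rewrite [LHS]exchange_big; apply: eq_bigr => j _ /=.
  rewrite mulr_suml; apply: eq_bigr => x _.
  by rewrite mulr_sumr; apply: eq_bigr => y _; rewrite mulrACA.
have B'1 y : `|B' y| <= 1 by apply: B1.
have := sum_mxtrace_correlation_sqr_le A1.
have := sum_mxtrace_correlation_sqr_le B'1.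
rewrite -/q -/(E _ _ _) => hB hA.
have q1 : 1 < q by apply: card_field_gt1.
rewrite normrM ger0_norm; last by lra.
(* Both square sums have the same bound, so the termwise inequality |e e'| <= (e^2 + e'^2) / 2 does
   the work of Cauchy-Schwarz. Squares being nonnegative, the sum may be extended from the
   invertible [s] to all [s]. *)
have le2 : `|\sum_(s in unitmx) \sum_j E A s j * E B' s j| <=
    \sum_s \sum_j (E A s j ^+ 2 + E B' s j ^+ 2) / 2.
  apply: le_trans (ler_norm_sum _ _ _) _.
  rewrite [leRHS](bigID (mem unitmx)) /=.
  apply: ler_wpDr.
    by apply: sumr_ge0 => s _; apply: sumr_ge0 => j _; rewrite divr_ge0
      ?addr_ge0 ?sqr_ge0.
  apply: ler_sum => s _; apply: le_trans (ler_norm_sum _ _ _) _.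
  apply: ler_sum => j _; rewrite ler_norml.
  have := sqr_ge0 (E A s j + E B' s j); have := sqr_ge0 (E A s j - E B' s j).
  by rewrite sqrrB sqrrD => *; apply/andP; split; lra.
have -> : (q - 1) * q ^+ (k * k) * q ^+ (k * k) =
   ((q - 1) * q ^+ (k * k) * q ^+ (k * k) + (q - 1) * q ^+ (k * k) * q ^+ (k *
     k)) / 2 by lra.
apply: le_trans (ler_wpM2l _ le2) _; first by lra.
under eq_bigr => s _ do rewrite -mulr_suml big_split /=.
rewrite -mulr_suml big_split /= mulrA ler_pM2r ?invr_gt0 // mulrDr.
exact: lerD.
Qed.

(** * Rank-one updates and the values of [Phi] *)

(** Some column of the cokernel of [A] is not annihilated by [u]; rescaled, it is [z]. *)
Lemma not_submx_separated (F : fieldType) m n (u : 'rV[F]_n) (A : 'M[F]_(m,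
  n)) :
  ~~ (u <= A)%MS -> exists z : 'cV_n, A *m z = 0 /\ u *m z = 1%:M.
Proof.
rewrite submxE; move v_def: (u *m cokermx A) => v /eqP v0.
have /existsP[j vj] : [exists j, v 0 j != 0].
  apply: contraT => /existsPn vj0; case: v0; apply/rowP => j; rewrite [RHS]mxE.
  by have := vj0 j; rewrite negbK => /eqP.
exists ((v 0 j)^-1 *: (cokermx A *m delta_mx j 0)).
rewrite -!scalemxAr [A *m _]mulmxA [u *m _]mulmxA v_def mulmx_coker mul0mx
  scaler0; split=> //.
by apply/matrixP => i l; rewrite -colE !ord1 !mxE mulVf.
Qed.

Lemma rank_lt_separated (F : fieldType) k (M : 'M[F]_k) : (\rank M < k)%N ->
  exists (b : 'rV_k) (z : 'cV_k), M *m z = 0 /\ b *m z = 1%:M.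
Proof.
move=> rM; have : ~~ (1%:M <= M)%MS by rewrite sub1mx /row_full neq_ltn rM.
by case/row_subPn => i /not_submx_separated[z]; exists (row i 1%:M), z.
Qed.

(* Wedderburn's rank reduction, read backwards. *)
Lemma mxrank_add_rank1 (F : fieldType) k (M : 'M[F]_k) (y b : 'rV_k)
    (a z : 'cV_k) :
  M *m z = 0 -> b *m z = 1%:M -> y *m M = 0 -> y *m a = 1%:M ->
  \rank (M + a *m b)%R = (\rank M).+1.
Proof.
move=> Mz bz yM ya; set N := M + a *m b.
have yN : y *m N = b by rewrite mulmxDr yM mulmxA ya mul1mx add0r.
have b_notin : ~~ (b <= M)%MS.
  apply/negP => /submxP[x bx]; move: bz; rewrite bx -mulmxA Mz mulmx0.
  by move/matrixP/(_ 0 0)/eqP; rewrite !mxE eq_sym oner_eq0.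
have -> : \rank N = \rank (M + b)%MS.
  apply/eqmx_rank/andP; split.
    by rewrite addmx_sub_adds // submxMl.
  rewrite addsmx_sub; apply/andP; split; last by rewrite -yN submxMl.
  have -> : M = (1%:M - a *m y) *m N.
    by rewrite mulmxBl mul1mx -mulmxA yN addrK.
  exact: submxMl.
apply/eqP; rewrite eqn_leq; apply/andP; split.
  apply: leq_trans (mxrank_adds_leqif M b) _.
  by rewrite -[leqRHS]addn1 leq_add2l rank_leq_row.
rewrite ltnNge; apply: contra b_notin => rle.
have := mxrank_leqif_sup (addsmxSl M b); rewrite addsmx_sub submx_refl /= => <-.
by rewrite eqn_leq rle mxrankS ?addsmxSl.
Qed.

Lemma card_submx (F : finFieldType) m n (A : 'M[F]_(m, n)) :
  #|[pred u : 'rV_n | (u <= A)%MS]| = (#|F| ^ \rank A)%N.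
Proof. by rewrite -card_rowg; apply: eq_card => u; rewrite !inE. Qed.

Lemma card_tr_submx (F : finFieldType) m n (A : 'M[F]_(m, n)) :
  #|[pred v : 'cV_m | (v^T <= A^T)%MS]| = (#|F| ^ \rank A)%N.
Proof.
rewrite -mxrank_tr -card_submx -!sum1_card (reindex (@trmx F 1 m)) /=.
  by apply: eq_bigl => u; rewrite !inE trmxK.
by exists trmx => u _; rewrite trmxK.
Qed.

Lemma Phi_mulmxr (R : realFieldType) (F : finFieldType) k (P M : 'M[F]_k) :
  P \in unitmx -> Phi R (M *m P) = Phi R M.
Proof.
move=> uP; rewrite /Phi [RHS](reindex_inj (can_inj (mulKmx uP))) /=.
apply: eq_big => [s|s _]; first by rewrite unitmx_mul uP.
by rewrite mulmxA mxtrace_mulC mulmxA.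
Qed.

Lemma Phi_mulmxl (R : realFieldType) (F : finFieldType) k (P M : 'M[F]_k) :
  P \in unitmx -> Phi R (P *m M) = Phi R M.
Proof.
move=> uP; rewrite /Phi [RHS](reindex_inj (can_inj (mulmxK uP))) /=.
apply: eq_big => [s|s _]; first by rewrite unitmx_mul uP andbT.
by rewrite mulmxA.
Qed.

Lemma Phi_rank (R : realFieldType) (F : finFieldType) k (M N : 'M[F]_k) :
  \rank M = \rank N -> Phi R M = Phi R N.
Proof.
move=> rMN; rewrite -(mulmx_ebase M) -(mulmx_ebase N) rMN.
by rewrite 2?(Phi_mulmxr _ _ (row_ebase_unit _)) 2?(Phi_mulmxl _ _
  (col_ebase_unit _)).
Qed.

(** For each invertible [s], the trace of [s *m a *m b] is a nonzero linear form in [a], hence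
    equidistributed, and [theta] sums to zero over the field. *)
Lemma sum_Phi_rank1 (R : realFieldType) (F : finFieldType) k (M : 'M[F]_k)
    (b : 'rV_k) (z : 'cV_k) :
  b *m z = 1%:M -> \sum_(a : 'cV_k) Phi R (M + a *m b) = 0.
Proof.
move=> bz; rewrite /Phi exchange_big big1 //= => s us.
apply: (sum_theta_equidistributed _ (tau := fun c => invmx s *m (c *: z))).
move=> a c; rewrite mulmxDl addrA mulmxDr raddfD /=; congr (_ + _).
by rewrite -mulmxA mulKVmx // -scalemxAl mxtraceZ mxtrace_mulC bz mxtrace1
  mulr1.
Qed.

(** A column a = M x turns the update into M (1 + x b). Moving [x] along the kernel vector [z]
    leaves M x unchanged and achieves b x = 0; then 1 - x b inverts the second factor. *)
Lemma Phi_add_col (R : realFieldType) (F : finFieldType) k (M : 'M[F]_k)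
    (b : 'rV_k) (a z : 'cV_k) :
  M *m z = 0 -> b *m z = 1%:M -> (a^T <= M^T)%MS ->
  Phi R (M + a *m b) = Phi R M.
Proof.
move=> Mz bz /submxP[x /(congr1 trmx)]; rewrite trmx_mul !trmxK => ->.
pose x' := x^T - z *m (b *m x^T).
have Mx' : M *m x^T = M *m x' by rewrite mulmxBr [M *m (z *m _)]mulmxA Mz
  mul0mx subr0.
have bx' : b *m x' = 0 by rewrite mulmxBr [b *m (z *m _)]mulmxA bz mul1mx subrr.
have -> : M + M *m x^T *m b = M *m (1%:M + x' *m b).
  by rewrite mulmxDr mulmx1 mulmxA Mx'.
apply: Phi_mulmxr.
have /mulmx1_unit[] // : (1%:M + x' *m b) *m (1%:M - x' *m b) = 1%:M.
rewrite mulmxDl !mulmxBr !mul1mx mulmx1 mulmxA -[x' *m b *m x']mulmxA bx'.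
by rewrite mulmx0 mul0mx subr0 subrK.
Qed.

(** Let r be the rank of [M]. In the vanishing sum of [sum_Phi_rank1], the q^r columns [a] in the
    column space of [M] each contribute [Phi M]; the other q^k - q^r raise the rank by one and each
    contribute [Phi N]. *)
Lemma Phi_rank_succ (R : realFieldType) (F : finFieldType) k (M N : 'M[F]_k) :
  \rank N = (\rank M).+1 ->
  Phi R M = (1 - #|F|%:R ^+ (k - \rank M)) * Phi R N.
Proof.
move=> rN; have rM : (\rank M < k)%N by rewrite -rN rank_leq_row.
have [b [z [Mz bz]]] := rank_lt_separated rM.
have q1 := card_field_gt1 R F; set q := #|F|%:R in q1 *.
have := sum_Phi_rank1 R M bz.
rewrite (bigID (fun a : 'cV_k => (a^T <= M^T)%MS)) /=.
under eq_bigr => a Ma do rewrite (Phi_add_col _ Mz bz Ma).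
under [X in _ + X]eq_bigr => a Ma.
  rewrite (@Phi_rank _ _ _ _ N).
    over.
  have [y [My ya]] := not_submx_separated Ma.
  rewrite rN (mxrank_add_rank1 (y := y^T) Mz bz) //.
    by rewrite -[y^T *m M]trmxK trmx_mul trmxK My trmx0.
  by rewrite -[y^T *m a]trmxK trmx_mul trmxK ya trmx1.
rewrite !sumr_const card_tr_submx.
have -> : #|[pred a : 'cV[F]_k | ~~ (a^T <= M^T)%MS]| =
    (#|F| ^ k - #|F| ^ \rank M)%N.
  have -> : (#|F| ^ k = #|{: 'cV[F]_k}|)%N by rewrite card_mx muln1.
  rewrite -card_tr_submx -(cardC [pred a : 'cV[F]_k | (a^T <= M^T)%MS]) addKn.
  by apply: eq_card => a; rewrite !inE.
rewrite -[X in X + _]mulr_natl -[X in _ + X]mulr_natl natrB; last first.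
  by rewrite leq_pexp2l ?(ltnW rM) // ltnW // card_finNzRing_gt1.
rewrite !natrX -/q.
have -> : q ^+ k = q ^+ \rank M * q ^+ (k - \rank M).
  by rewrite -exprD subnKC // ltnW.
have : q ^+ \rank M != 0 by rewrite expf_neq0 // gt_eqF //; lra.
move: (q ^+ \rank M) (q ^+ (k - \rank M)) => u v u0 e.
apply: (mulfI u0); apply/eqP; rewrite -subr_eq0 -e; apply/eqP; ring.
Qed.

(** The q-Pochhammer symbol (q; q)_d. *)
Definition qpoch (R : comNzRingType) (q : R) (d : nat) : R :=
  \prod_(i < d) (1 - q ^+ i.+1).

Lemma qpochS (R : comNzRingType) (q : R) d :
  qpoch q d.+1 = qpoch q d * (1 - q ^+ d.+1).
Proof. by rewrite /qpoch big_ord_recr. Qed.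

Lemma Phi_val (R : realFieldType) (F : finFieldType) k (M : 'M[F]_k) :
  Phi R M = qpoch #|F|%:R (k - \rank M) * Phi R (1%:M : 'M[F]_k).
Proof.
move d_def: (k - \rank M)%N => d; elim: d M d_def => [|d IHd] M rM.
  rewrite /qpoch big_ord0 mul1r; apply: Phi_rank; rewrite mxrank1.
  by apply/eqP; rewrite eqn_leq rank_leq_row -subn_eq0 rM.
have rN : \rank (pid_mx (\rank M).+1 : 'M[F]_k) = (\rank M).+1.
  by rewrite rank_pid_mx // -subn_gt0 rM.
rewrite (Phi_rank_succ _ rN) rM (IHd (pid_mx _)) ?rN ?subnS ?rM //.
by rewrite qpochS mulrCA mulrA.
Qed.

Lemma card_unitmx (F : finFieldType) k :
  #|(unitmx : {pred 'M[F]_k.+1})| =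
  (#|F| ^ 'C(k.+1, 2) * \prod_(i < k.+1) (#|F| ^ i.+1 - 1))%N.
Proof.
have := card_GL F (ltn0Sn k).
rewrite big_add1 big_mkord => <-; rewrite cardsT card_sub.
by apply: eq_card => s; rewrite !inE.
Qed.

Lemma norm_qpoch (R : realFieldType) (F : finFieldType) d :
  `|qpoch #|F|%:R d : R| = (\prod_(i < d) (#|F| ^ i.+1 - 1))%:R.
Proof.
rewrite natr_prod normr_prod; apply: eq_bigr => i _.
have q1 : (1 <= #|F| ^ i.+1)%N by rewrite expn_gt0 ltnW // card_finNzRing_gt1.
by rewrite natrB // natrX distrC ger0_norm // subr_ge0 -natrX ler1n.
Qed.

Lemma qpoch_neq0 (R : realFieldType) (F : finFieldType) d :
  qpoch #|F|%:R d != 0 :> R.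
Proof.
rewrite -normr_gt0 norm_qpoch ltr0n prodn_gt0 // => i.
by rewrite subn_gt0 -(exp1n i.+1) ltn_exp2r // card_finNzRing_gt1.
Qed.

(** At the zero matrix [Phi] is q - 1 times the order of GL, whose product formula shares all its
    factors q^i - 1 with [qpoch]. *)
Lemma norm_Phi1 (R : realFieldType) (F : finFieldType) k :
  `|Phi R (1%:M : 'M[F]_k.+1)| = (#|F|%:R - 1) * #|F|%:R ^+ 'C(k.+1, 2).
Proof.
have := Phi_val R (0 : 'M[F]_k.+1); rewrite mxrank0 subn0.
rewrite /Phi; under eq_bigr => s _ do rewrite mulmx0 mxtrace0 /theta eqxx mulr1.
rewrite sumr_const card_unitmx => /(congr1 Num.norm).
rewrite normrM norm_qpoch -[X in `|X|]mulr_natl normrM normr_nat natrM.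
rewrite ger0_norm; last by have := card_field_gt1 R F; lra.
rewrite mulrC mulrA mulrC => e.
have q0 : (\prod_(i < k.+1) (#|F| ^ i.+1 - 1))%:R != 0 :> R.
  by rewrite -norm_qpoch normr_eq0 qpoch_neq0.
by apply: (mulfI q0); rewrite -e natrX.
Qed.

(** * Counting matrices by corank *)

Lemma mx11_eq1 (F : fieldType) (M : 'M[F]_1) : (M == 1%:M) = (M 0 0 == 1).
Proof.
apply/eqP/eqP => [->|M00]; first by rewrite mxE.
by apply/matrixP => i j; rewrite !ord1 M00 mxE.
Qed.

Lemma card_cV_affine (F : finFieldType) l (y : 'rV[F]_l) : y != 0 ->
  (#|F| * #|[pred a : 'cV_l | y *m a == 1%:M]| = #|F| ^ l)%N.
Proof.
rewrite -submx0 => /not_submx_separated[a0 [_ ya0]].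
have := @card_equidistributed F 'cV_l (fun a => (y *m a) 0 0)
  (fun c => c *: a0) 1.
rewrite card_mx muln1 => <- => [|a c].
  by congr (_ * _)%N; apply: eq_card => a; rewrite !inE mx11_eq1.
by rewrite mulmxDr -scalemxAr ya0 mxE !mxE mulr1.
Qed.

Lemma card_trmx (F : finType) m n (P : pred 'M[F]_(m, n)) :
  #|P| = #|[pred v : 'M[F]_(n, m) | P v^T]|.
Proof.
rewrite -!sum1_card (reindex (@trmx F n m)) //.
by exists trmx => u _; rewrite trmxK.
Qed.

Lemma card_rV_affine (F : finFieldType) l (z : 'cV[F]_l) : z != 0 ->
  (#|F| * #|[pred b : 'rV_l | b *m z == 1%:M]| = #|F| ^ l)%N.
Proof.
rewrite -trmx_eq0 => /card_cV_affine <-; rewrite card_trmx; congr (_ * _)%N.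
apply: eq_card => b; rewrite !inE -(inj_eq trmx_inj) trmx_mul trmxK.
by rewrite trmx1.
Qed.

Lemma card_lker (F : finFieldType) l (w : 'M[F]_l) :
  #|[pred y : 'rV_l | (y *m w == 0) && (y != 0)]| = (#|F| ^ (l - \rank w) -
    1)%N.
Proof.
rewrite -mxrank_ker -card_submx.
rewrite [in RHS](cardD1 (0 : 'rV_l)) inE sub0mx add1n subn1 /=.
by apply: eq_card => y; rewrite !inE andbC sub_kermx.
Qed.

Lemma card_rker (F : finFieldType) l (w : 'M[F]_l) :
  #|[pred z : 'cV_l | (w *m z == 0) && (z != 0)]| = (#|F| ^ (l - \rank w) -
    1)%N.
Proof.
rewrite -mxrank_tr -card_lker card_trmx; apply: eq_card => y.
by rewrite !inE -trmx_eq0 trmx_mul trmxK trmx_eq0.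
Qed.

Definition corank_class (F : finFieldType) l d :=
  [pred w : 'M[F]_l | (l - \rank w == d)%N].

(* Both sides count the rank-one updates leading from corank d + 1 to corank d:
   w' = w + a b with w z = 0, y w = 0, b z = 1 and y a = 1 is sent to
   (w', z, y), which satisfies y w' z = 1 and determines a = w' z, b = y w'. *)
Lemma card_corank_succ (F : finFieldType) l d :
  (#|corank_class F l d.+1| * (#|F| ^ d.+1 - 1) ^ 2
     <= #|F| * #|corank_class F l d|)%N.
Proof.
set q := #|F|; have q_gt0 : (0 < q)%N by rewrite ltnW // card_finNzRing_gt1.
pose ker := [pred p : 'M[F]_l * ('cV[F]_l * 'rV[F]_l) |
  (p.1 \in corank_class F l d.+1) &&
  (((p.1 *m p.2.1 == 0) && (p.2.1 != 0)) &&
   ((p.2.2 *m p.1 == 0) && (p.2.2 != 0)))].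
pose upd (p : 'M[F]_l * ('cV[F]_l * 'rV[F]_l)) :=
  [pred c : 'cV[F]_l * 'rV[F]_l |
    (p.2.2 *m c.1 == 1%:M) && (c.2 *m p.2.1 == 1%:M)].
pose X := [pred t | ker t.1 && upd t.1 t.2].
pose Y := [pred p : 'M[F]_l * ('cV[F]_l * 'rV[F]_l) |
  (p.1 \in corank_class F l d) && (p.2.2 *m (p.1 *m p.2.1) == 1%:M)].
(* For nonzero [y] and [z], each of the conditions y a = 1 and b z = 1 selects a fraction 1/q of the
   vectors. *)
have cardX : (q * q * #|X| = #|corank_class F l d.+1| * (q ^ d.+1 - 1) ^ 2 *
    (q ^ l * q ^ l))%N.
  have cardker : #|ker| = (#|corank_class F l d.+1| * (q ^ d.+1 - 1) ^ 2)%N.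
    rewrite -sum1_card -(pair_big_dep _ (fun w c =>
      ((w *m c.1 == 0) && (c.1 != 0)) && ((c.2 *m w == 0) && (c.2 != 0)))
      (fun _ _ => 1%N)) /= -sum_nat_const.
    apply: eq_bigr => w /eqP rw.
    rewrite -(pair_big [pred z | (w *m z == 0) && (z != 0)]
      [pred y | (y *m w == 0) && (y != 0)] (fun _ _ => 1%N)) /=.
    under eq_bigr => z _ do rewrite sum1_card card_lker rw.
    by rewrite sum_nat_const card_rker rw.
  rewrite -cardker -[RHS]sum_nat_const -sum1_card.
  rewrite -(pair_big_dep _ (fun p c => upd p c) (fun _ _ => 1%N)) /=.
  rewrite big_distrr /=. apply: eq_big => [p|[w [z y]]]; first by rewrite !inE.
  case/andP => _ /= /andP[/andP[_ z0] /andP[_ y0]].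
  rewrite -(pair_big [pred a | y *m a == 1%:M] [pred b | b *m z == 1%:M]
    (fun _ _ => 1%N)) /=.
  under eq_bigr => a _ do rewrite sum1_card.
  by rewrite sum_nat_const mulnACA card_cV_affine // card_rV_affine.
(* Only an inequality: a column [z] with w z = 0 admits no [y], but is counted on the right like any
   other. *)
have cardY : (q * #|Y| <= #|corank_class F l d| * (q ^ l * q ^ l))%N.
  rewrite -[leqRHS]sum_nat_const -sum1_card.
  rewrite -(pair_big_dep _ (fun w c => c.2 *m (w *m c.1) == 1%:M)
    (fun _ _ => 1%N)) /=.
  rewrite big_distrr; apply: leq_sum => w _.
  rewrite -(pair_big_dep xpredT (fun z y => y *m (w *m z) == 1%:M)
    (fun _ _ => 1%N)) /=.
  have {1}-> : (q ^ l = #|{: 'cV[F]_l}|)%N by rewrite card_mx muln1.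
  rewrite big_distrr -sum_nat_const; apply: leq_sum => z _.
  rewrite sum1_card; have [wz0|/card_rV_affine qz] := eqVneq (w *m z) 0; last
    first.
    by rewrite -qz leqnn.
  rewrite eq_card0 => [|y]; first by rewrite /= muln0.
  rewrite [RHS]inE; apply/negbTE; change (y *m (w *m z) != 1%:M).
  rewrite wz0 mulmx0 eq_sym; apply/eqP => /matrixP/(_ 0 0)/eqP.
  by rewrite !mxE oner_eq0.
have XY : (#|X| <= #|Y|)%N.
  pose f (t : ('M[F]_l * ('cV[F]_l * 'rV[F]_l)) * ('cV[F]_l * 'rV[F]_l)) :=
    (t.1.1 + t.2.1 *m t.2.2, t.1.2).
  have fX t : t \in X -> [/\ t.2.1 = (f t).1 *m t.1.2.1,
      t.2.2 = t.1.2.2 *m (f t).1 & f t \in Y].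
    case: t => -[w [z y]] [a b] /=; rewrite !inE /=.
    case/andP => /andP[/eqP rw /andP[/andP[/eqP wz _] /andP[/eqP yw _]]].
    case/andP => /eqP ya /eqP bz.
    have az : (w + a *m b) *m z = a by rewrite mulmxDl wz -mulmxA bz mulmx1
      add0r.
    rewrite mulmxDr yw mulmxA ya mul1mx add0r az ya eqxx andbT.
    by rewrite (mxrank_add_rank1 wz bz yw ya) subnS rw.
  have f_inj : {in X &, injective f}.
    move=> t t' /fX[ta tb _] /fX[ta' tb' _] ftt'.
    have t12 : t.1.2 = t'.1.2 by case: ftt'.
    have t21 : t.2.1 = t'.2.1 by rewrite ta ta' ftt' t12.
    have t22 : t.2.2 = t'.2.2 by rewrite tb tb' ftt' t12.
    case: t t' t12 t21 t22 ftt' {ta tb ta' tb'} => -[w c] [a b] [[w' c'] [a'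
      b']] /=.
    by move=> -> -> -> [/addIr ->].
  rewrite -(card_in_image f_inj); apply/subset_leq_card/fintype.subsetP => p.
  by case/fintype.imageP => t /fX[_ _ ftY] ->.
have q2l : (0 < q ^ l * q ^ l)%N by rewrite muln_gt0 !expn_gt0 q_gt0.
rewrite -(leq_pmul2r q2l) -cardX -!mulnA leq_pmul2l //.
by apply: leq_trans cardY; rewrite leq_mul2l XY orbT.
Qed.

(** * The witness *)

(** A vector [z] with w z = 0 and u z = 1 combines the last columns into one supported in the
    corner, so a column operation changes the corner at will. *)
Lemma mxrank_block_shift (F : fieldType) l (a b : 'M[F]_1) (u : 'rV_l)
    (v : 'cV_l) (w : 'M[F]_l) : ~~ (u <= w)%MS ->
  \rank (block_mx a u v w) = \rank (block_mx b u v w).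
Proof.
case/not_submx_separated => z [wz uz].
have -> : block_mx b u v w = block_mx a u v w *m block_mx 1%:M 0 (z *m (b -
  a)) 1%:M.
  rewrite mulmx_block !mulmx1 !mulmx0 !add0r !mulmxA uz wz mul1mx mul0mx addr0.
  by rewrite addrC subrK.
by rewrite mxrankMfree // row_free_unit unitmxE det_lblock !det1 mulr1 unitr1.
Qed.

Lemma mxrank_block_shift_tr (F : fieldType) l (a b : 'M[F]_1) (u : 'rV_l)
    (v : 'cV_l) (w : 'M[F]_l) : ~~ (v^T <= w^T)%MS ->
  \rank (block_mx a u v w) = \rank (block_mx b u v w).
Proof.
rewrite -[LHS]mxrank_tr -[RHS]mxrank_tr !tr_block_mx.
exact: mxrank_block_shift.
Qed.

(* For singular w this is the intended value only when u and v^T lie in the row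
   spaces of w and w^T. *)
Definition schur (F : fieldType) l (u : 'rV[F]_l) (v : 'cV_l) (w : 'M[F]_l) :
  F :=
  (u *m pinvmx w *m v) 0 0.

(** Writing [u] and [v] as combinations of the rows and columns of [w], block elimination leaves the
    diagonal blocks [a - schur u v w] and [w]. *)
Lemma mxrank_block (F : fieldType) l (a : F) (u : 'rV_l) (v : 'cV_l)
    (w : 'M[F]_l) : (u <= w)%MS -> (v^T <= w^T)%MS ->
  \rank (block_mx a%:M u v w) = ((a != schur u v w) + \rank w)%N.
Proof.
move=> /mulmxKpV uw /submxP[x /(congr1 trmx)]; rewrite trmx_mul !trmxK => vw.
set y := u *m pinvmx w in uw.
have -> : block_mx a%:M u v w = block_mx 1%:M y 0 1%:M *m
    (block_mx (a - schur u v w)%:M 0 0 w *m block_mx 1%:M 0 x^T 1%:M).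
  rewrite !mulmx_block !mulmx1 !mul1mx !mul0mx !mulmx0 !add0r !addr0 -vw uw.
  congr block_mx; rewrite [y *m _]mx11_scalar -/(schur u v w) -raddfD /=.
  by rewrite subrK.
have lunit : (block_mx 1%:M y 0 1%:M : 'M[F]_(1 + l)) \in unitmx.
  by rewrite unitmxE det_ublock !det1 mulr1 unitr1.
rewrite (eqmxMfull _ (_ : row_full _)) ?row_full_unit // mxrankMfree; last
  first.
  by rewrite row_free_unit unitmxE det_lblock !det1 mulr1 unitr1.
rewrite rank_diag_block_mx rank_rV; congr (nat_of_bool (~~ _) + _)%N.
rewrite -[a == _]subr_eq0; apply/eqP/eqP => [/matrixP/(_ 0 0)|->]; last by
  rewrite raddf0.
by rewrite !mxE.
Qed.

(** By [Phi_val], this is [Phi] divided by its value at the identity. *)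
Definition phi (R : realFieldType) (F : finFieldType) k (M : 'M[F]_k) : R :=
  qpoch #|F|%:R (k - \rank M).

Definition psi (R : realFieldType) (F : finFieldType) l (W : 'M[F]_(1 + l)) :
  R :=
  phi R W - phi R (W - block_mx 1%:M 0 0 0).

(** This is [qpoch q d - qpoch q d.+1], the drop of [phi] when the corank grows from d to d + 1. *)
Definition mass (R : realFieldType) (F : finFieldType) (d : nat) : R :=
  qpoch #|F|%:R d * #|F|%:R ^+ d.+1.

(** If [u] or [v] leaves the row or column space of [w], the rank ignores the corner and the two
    terms cancel. Otherwise they differ only if [a] or [a - 1] equals the Schur complement. *)
Lemma psi_block (R : realFieldType) (F : finFieldType) l (a : F) (u : 'rV_l)
    (v : 'cV_l) (w : 'M[F]_l) :
  psi R (block_mx a%:M u v w) =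
    ((u <= w)%MS && (v^T <= w^T)%MS)%:R * mass R F (l - \rank w) *
    ((schur u v w + 1 == a)%:R - (schur u v w == a)%:R).
Proof.
have -> : psi R (block_mx a%:M u v w) =
    phi R (block_mx a%:M u v w) - phi R (block_mx (a - 1)%:M u v w).
  by rewrite /psi opp_block_mx add_block_mx !oppr0 !addr0 -raddfB.
have [uw|uw] := boolP (u <= w)%MS; last first.
  by rewrite /phi (mxrank_block_shift a%:M (a - 1)%:M v uw) subrr !mul0r.
have [vw|vw] := boolP (v^T <= w^T)%MS; last first.
  by rewrite /phi (mxrank_block_shift_tr a%:M (a - 1)%:M u vw) subrr !mul0r.
rewrite mul1r /phi !mxrank_block // subr_eq -[a == _]eq_sym [a == _ + 1]eq_sym.
have e (b : bool) : (1 + l - (~~ b + \rank w) = l - \rank w + b)%N.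
  by have := rank_leq_row w; case: b => /=; lia.
rewrite !e /mass; have [<-|_] := eqVneq (schur u v w + 1) a.
  rewrite -subr_eq0 opprD addrA subrr add0r oppr_eq0 oner_eq0 addn0 addn1.
  by rewrite qpochS mulr1n mulr0n; ring.
by have [_|_] := eqVneq (schur u v w) a; rewrite ?addn1 ?addn0 ?qpochS ?mulr1n
  ?mulr0n; ring.
Qed.

Lemma sum_block (R : nmodType) (F : finFieldType) l (G : 'M[F]_(1 + l) -> R) :
  \sum_W G W = \sum_w \sum_u \sum_v \sum_a G (block_mx a%:M u v w).
Proof.
rewrite pair_big pair_big pair_big /=.
apply: (reindex (fun p => block_mx p.2%:M p.1.1.2 p.1.2 p.1.1.1)).
exists (fun W : 'M[F]_(1 + l) =>
  ((drsubmx W, ursubmx W, dlsubmx W), ulsubmx W 0 0)) => [p _|W _] /=.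
  rewrite block_mxKdr block_mxKur block_mxKdl block_mxKul mxE eqxx mulr1n.
  by case: p => -[[]].
by rewrite -mx11_scalar submxK.
Qed.

Lemma sum_block_psi (R : realFieldType) (F : finFieldType) l
    (B : 'M[F]_(1 + l) -> R) :
  \sum_W psi R W * B W = \sum_w mass R F (l - \rank w) *
    \sum_(u | (u <= w)%MS) \sum_(v : 'cV_l | (v^T <= w^T)%MS)
      (B (block_mx (schur u v w + 1)%:M u v w) - B (block_mx (schur u v w)%:M
        u v w)).
Proof.
rewrite sum_block; apply: eq_bigr => w _; rewrite mulr_sumr [RHS]big_mkcond.
apply: eq_bigr => u _.
have [uw|uw] := ifPn; last first.
  rewrite big1 // => v _; rewrite big1 // => a _.
  by rewrite psi_block (negPf uw) !mul0r.
rewrite mulr_sumr [RHS]big_mkcond /=; apply: eq_bigr => v _; have [vw|vw] :=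
  ifPn; last first.
  by rewrite big1 // => a _; rewrite psi_block (negPf vw) andbF !mul0r.
under eq_bigr => a _ do rewrite psi_block uw vw mul1r -mulrA mulrBl.
rewrite -mulr_sumr sumrB.
by rewrite !(sumr_indicator _ (fun a => B (block_mx a%:M u v w))).
Qed.

(** * Decay of the mass with the corank *)

(** The constant is 1/2 times 1 / (1 - 1/8). The induction carries the tail of a geometric series of
    ratio 1/8. *)
Lemma sum_geometric_le (R : realFieldType) (h : nat -> R) n :
    (forall d, 0 <= h d) -> 2 * h 1%N <= h 0%N ->
    (forall d, 8 * h d.+2 <= h d.+1) ->
  \sum_(i < n) h i.+1 <= 4 / 7 * h 0%N.
Proof.
move=> h0 h1 h2; suff : \sum_(i < n) h i.+1 + h n.+1 * 8 / 7 <= 8 / 7 * h 1%N.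
  by have := h0 n.+1; lra.
elim: n => [|n IHn]; first by rewrite big_ord0; lra.
by rewrite big_ord_recr /=; have := h2 n; lra.
Qed.

(** The part of the l1 norm of [psi] carried by the blocks [w] of corank d: two corner values, and
    q^(l - d) choices for each of [u] and [v]. *)
Definition class_mass (R : realFieldType) (F : finFieldType) (l d : nat) : R :=
  #|corank_class F l d|%:R * (2 * `|mass R F d| * #|F|%:R ^+ (2 * (l - d))).

Lemma class_mass_ge0 (R : realFieldType) (F : finFieldType) l d :
  0 <= class_mass R F l d.
Proof. by rewrite /class_mass !mulr_ge0 ?exprn_ge0. Qed.

(** One of the two factors q^(d + 1) - 1 in [card_corank_succ] is spent on the growth of [mass], and
    the remaining powers of q cancel. *)
Lemma class_mass_succ (R : realFieldType) (F : finFieldType) l d :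
  (#|F|%:R ^+ d.+1 - 1) * class_mass R F l d.+1 <= class_mass R F l d.
Proof.
(* For d >= l no matrix has corank d + 1, so the left-hand side is zero; this disposes of the
   truncated [l - d.+1]. *)
have [dl|dl] := ltnP d l; last first.
  rewrite [class_mass _ _ _ d.+1]/class_mass.
  rewrite [#|corank_class F l d.+1|]eq_card0 ?mul0r ?mulr0 ?class_mass_ge0 //
    => w.
  by rewrite !inE; apply/negP => /eqP; have := rank_leq_row w; lia.
have := card_corank_succ F l d.
have q1 := card_field_gt1 R F.
have qd1 : 1 <= #|F|%:R ^+ d.+1 :> R by rewrite exprn_ege1 // ltW.
rewrite -(ler_nat R) natrM natrX natrM natrB ?natrX; last by rewrite -(ler_nat
  R) natrX.
rewrite /class_mass /mass !normrM qpochS normrM.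
rewrite [`|1 - _|]distrC [`|_ - 1|]ger0_norm ?subr_ge0 //.
rewrite !(ger0_norm (exprn_ge0 _ (ler0n R #|F|))).
have -> : (2 * (l - d) = (2 * (l - d.+1)).+2)%N by lia.
move: (2 * (l - d.+1))%N => m; rewrite normr_nat [_ ^+ m.+2]exprS [_ ^+
  m.+1]exprS.
move: (#|corank_class F l d.+1|%:R) (#|corank_class F l d|%:R) => N' N hN.
set q := #|F|%:R in q1 qd1 hN *; set Q := `|_|; set qd := q ^+ d.+1.
set qm := q ^+ m.
have c0 : 0 <= 2 * Q * q * qd * qm.
  by rewrite !mulr_ge0 ?exprn_ge0 ?normr_ge0 //; lra.
have := ler_wpM2l c0 hN; rewrite -/qd.
by lra.
Qed.

Lemma sumr_le_card (R : realFieldType) (T : finType) (P : pred T) (G : T -> R)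
    (c : R) : (forall x, P x -> G x <= c) ->
  \sum_(x | P x) G x <= #|[pred x | P x]|%:R * c.
Proof.
by move=> Gc; rewrite mulr_natl -sumr_const; apply: ler_sum => x; apply: Gc.
Qed.

(** Invertible [w] contribute at most -9/10 of [class_mass] at corank 0, singular [w] at most 4/7 of
    it, and -9/10 + 4/7 = -23/70 < -3/10. *)
Lemma sum_psi_le (R : realFieldType) (F : finFieldType) l
    (B : 'M[F]_(1 + l) -> R) : (3 <= #|F|)%N ->
    (forall W, `|B W| <= 1) ->
    (forall u v w, w \in unitmx ->
      9 / 10 <= B (block_mx (schur u v w)%:M u v w) /\
      B (block_mx (schur u v w + 1)%:M u v w) <= - (9 / 10)) ->
  \sum_W psi R W * B W <= - (3 / 10) * class_mass R F l 0.
Proof.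
move=> q3 B1 BH; rewrite sum_block_psi.
pose T (w : 'M[F]_l) := mass R F (l - \rank w) *
  \sum_(u | (u <= w)%MS) \sum_(v : 'cV_l | (v^T <= w^T)%MS)
    (B (block_mx (schur u v w + 1)%:M u v w) - B (block_mx (schur u v w)%:M u
      v w)).
rewrite -[leLHS]/(\sum_w T w).
rewrite (partition_big (fun w : 'M[F]_l => inord (l - \rank w) : 'I_l.+1)
  xpredT) //=.
have inordE (w : 'M[F]_l) (d : 'I_l.+1) :
    (inord (l - \rank w) == d) = (w \in corank_class F l d).
  by rewrite !inE -(inj_eq val_inj) /= inordK // ltnS leq_subr.
under eq_bigr => d _ do under eq_bigl => w do rewrite inordE.
rewrite big_ord_recl.
have Tle d w : w \in corank_class F l d ->
    T w <= 2 * `|mass R F d| * #|F|%:R ^+ (2 * (l - d)).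
  move=> /eqP rw; rewrite /T rw.
  have rwl : \rank w = (l - d)%N by have := rank_leq_row w; lia.
  rewrite mul2n -addnn exprD -!natrX -rwl -{1}card_submx -card_tr_submx.
  apply: le_trans (ler_norm _) _; rewrite normrM [2 * _]mulrC -mulrA.
  apply: ler_wpM2l => //; rewrite mulrC -mulrA.
  apply: le_trans (ler_norm_sum _ _ _) (sumr_le_card _) => u _.
  apply: le_trans (ler_norm_sum _ _ _) (sumr_le_card _) => v _.
  apply: le_trans (ler_normB _ _) _.
  by have := B1 (block_mx (schur u v w + 1)%:M u v w);
     have := B1 (block_mx (schur u v w)%:M u v w); lra.
have T0 : \sum_(w in corank_class F l 0) T w <= - (9 / 10) * class_mass R F l 0.
  have -> : - (9 / 10) * class_mass R F l 0 = #|corank_class F l 0|%:R *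
     - (9 / 5 * `|mass R F 0| * #|F|%:R ^+ (2 * l)).
    by rewrite /class_mass subn0; field.
  apply: sumr_le_card => w /eqP w0.
  have wu : w \in unitmx.
    by rewrite -row_full_unit /row_full eqn_leq rank_leq_row -subn_eq0 w0.
  have m0 : 0 <= mass R F 0 by rewrite /mass /qpoch big_ord0 mul1r exprn_ge0.
  rewrite /T w0 ger0_norm // -[_ * _ * _ ^+ _]mulrA [9 / 5 * _]mulrCA -[-
    (mass R F 0 * _)]mulrN; apply: ler_wpM2l => //.
  have ql : (#|F| ^ l = #|F| ^ \rank w)%N by rewrite mxrank_unit.
  rewrite mul2n -addnn exprD -!natrX ql -{1}card_submx -card_tr_submx.
  rewrite [9 / 5 * _]mulrCA -mulrN.
  apply: sumr_le_card => u _; rewrite mulrC -mulrN.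
  by apply: sumr_le_card => v _; have [] := BH u v w wu; lra.
have Td : \sum_(i < l) \sum_(w in corank_class F l (lift ord0 i)) T w <=
    \sum_(i < l) class_mass R F l i.+1.
  by apply: ler_sum => i _; apply: sumr_le_card => w wi; apply: Tle.
apply: le_trans (lerD T0 Td) _.
have q3R : 3 <= #|F|%:R :> R by rewrite ler_nat.
have := @sum_geometric_le R (class_mass R F l) l (class_mass_ge0 R F l).
have := class_mass_ge0 R F l 0.
have h1 : 2 * class_mass R F l 1 <= class_mass R F l 0.
  apply: le_trans (class_mass_succ R F l 0); rewrite ler_wpM2r ?class_mass_ge0
    //.
  by rewrite expr1; lra.
have h2 d : 8 * class_mass R F l d.+2 <= class_mass R F l d.+1.
  apply: le_trans (class_mass_succ R F l d.+1); rewrite ler_wpM2r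
    ?class_mass_ge0 //.
  rewrite !exprS; have : 1 <= #|F|%:R ^+ d :> R by rewrite exprn_ege1 //; lra.
  move: (#|F|%:R) (#|F|%:R ^+ d) q3R => q x q3R x1; nra.
by move=> ? /(_ h1 h2); lra.
Qed.

(** * Protocols *)

(** Each message splits the sum in two, multiplying [A] or [B] by an indicator. Arbitrary weights
    bounded by 1 are stable under this, and every leaf is a single bilinear form. The maps [e1] and
    [e2] let the protocol run on embedded inputs. *)
Lemma protocol_sum_le (R : realFieldType) (X Y : finType) (X' Y' : Type)
    (e1 : X -> X') (e2 : Y -> Y') (M : X -> Y -> R) (bound : R) :
  (forall A B, (forall x, `|A x| <= 1) -> (forall y, `|B y| <= 1) ->
     `|\sum_x \sum_y A x * B y * M x y| <= bound) ->
  forall (t : protocol X' Y') A B,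
     (forall x, `|A x| <= 1) -> (forall y, `|B y| <= 1) ->
  `|\sum_x \sum_y A x * B y * (M x y * (-1) ^+ ~~ run t (e1 x) (e2 y))| <=
    2 ^+ height t * bound.
Proof.
move=> hM; have bound_ge0 : 0 <= bound.
  by apply: le_trans (hM (fun=> 0) (fun=> 0) _ _) => // ?; rewrite normr0.
have restrict (T : Type) (A : T -> R) (P : T -> bool) (b : bool) :
    (forall x, `|A x| <= 1) -> forall x, `|A x * (P x == b)%:R| <= 1.
  move=> A1 x; rewrite normrM normr_nat.
  by case: (P x == b); rewrite ?mulr1 ?mulr0.
have le_max h0 h1 h s0 s1 : (h0 <= h)%N -> (h1 <= h)%N ->
    `|s0| <= 2 ^+ h0 * bound -> `|s1| <= 2 ^+ h1 * bound ->
    `|s1 + s0 : R| <= 2 ^+ h.+1 * bound.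
  move=> h0h h1h s0h s1h; apply: le_trans (ler_normD _ _) _.
  have mono i : (i <= h)%N -> 2 ^+ i * bound <= 2 ^+ h * bound.
    by move=> ih; rewrite ler_wpM2r // ler_weXn2l // ler1n.
  have := mono _ h0h; have := mono _ h1h; rewrite exprS -mulrA.
  by move: s0h s1h; lra.
elim=> [b|a t0 IH0 t1 IH1|a t0 IH0 t1 IH1] A B A1 B1 /=.
- rewrite expr0 mul1r.
  under eq_bigr => x _ do under eq_bigr => y _ do rewrite mulrA.
  under eq_bigr => x _ do rewrite -mulr_suml.
  by rewrite -mulr_suml normrM normrX normrN1 expr1n mulr1 hM.
- have := le_max _ _ _ _ _ (leq_maxl (height t0) (height t1)) (leq_maxr _ _)
    (IH0 _ B (restrict _ A (fun x => a (e1 x)) false A1) B1)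
    (IH1 _ B (restrict _ A (fun x => a (e1 x)) true A1) B1).
  congr (`|_| <= _); rewrite -big_split; apply: eq_bigr => x _.
  rewrite -big_split; apply: eq_bigr => y _ /=.
  by case: (a (e1 x)); rewrite /= ?mulr1 ?mulr0 !mul0r ?addr0 ?add0r.
- have := le_max _ _ _ _ _ (leq_maxl (height t0) (height t1)) (leq_maxr _ _)
    (IH0 A _ A1 (restrict _ B (fun y => a (e2 y)) false B1))
    (IH1 A _ A1 (restrict _ B (fun y => a (e2 y)) true B1)).
  congr (`|_| <= _); rewrite -big_split; apply: eq_bigr => x _.
  rewrite -big_split; apply: eq_bigr => y _ /=.
  by case: (a (e2 y)); rewrite /= ?mulr1 ?mulr0 ?mul0r ?addr0 ?add0r.
Qed.

(** The shift by [D] is absorbed into the weight [B], so the form is a difference of two forms in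
    [Phi], divided by [Phi] at the identity. *)
Lemma psi_bilinear_le (R : realFieldType) (F : finFieldType) l
    (A B : 'M[F]_(1 + l) -> R) :
    (forall x, `|A x| <= 1) -> (forall y, `|B y| <= 1) ->
  `|\sum_x \sum_y A x * B y * psi R (x + y)| <=
    2 * #|F|%:R ^+ (2 * (l.+1 * l.+1)) / #|F|%:R ^+ 'C(l.+1, 2).
Proof.
move=> A1 B1; pose D : 'M[F]_(1 + l) := block_mx 1%:M 0 0 0.
have q1 := card_field_gt1 R F.
have nPhi1 := norm_Phi1 R F l.
have phiE (W : 'M[F]_(1 + l)) :
    psi R W * Phi R (1%:M : 'M[F]_(1 + l)) = Phi R W - Phi R (W - D).
  by rewrite /psi /phi mulrBl -!Phi_val.
have split : (\sum_x \sum_y A x * B y * psi R (x + y)) *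
    Phi R (1%:M : 'M[F]_(1 + l)) =
    \sum_x \sum_y A x * B y * Phi R (x + y) -
    \sum_x \sum_y A x * B (y + D) * Phi R (x + y).
  rewrite mulr_suml -sumrB; apply: eq_bigr => x _.
  rewrite mulr_suml [in X in _ - X](reindex_inj (addIr (- D))) /= -sumrB.
  by apply: eq_bigr => y _; rewrite -mulrA phiE subrK addrA mulrBr.
have := Phi_bilinear_le A1 (fun y => B1 (y + D)).
have := Phi_bilinear_le A1 B1.
move=> h1 h2; rewrite ler_pdivlMr ?exprn_gt0 //; last by lra.
have q10 : 0 < #|F|%:R - 1 :> R by lra.
rewrite -(ler_pM2l q10) mulrCA -nPhi1 -normrM split.
apply: le_trans (ler_normB _ _) _.
apply: le_trans (lerD h1 h2) _.
by rewrite mul2n -addnn exprD; lra.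
Qed.

(* Alice uses [emb] and Bob [emb0], so that emb x + emb0 y = emb (x + y). *)
Definition emb (F : fieldType) l (W : 'M[F]_(1 + l)) : 'M[F]_(1 + (1 + l)) :=
  block_mx 0 (row_mx 1%:M 0) (col_mx 1%:M 0) W.

Definition emb0 (F : fieldType) l (W : 'M[F]_(1 + l)) : 'M[F]_(1 + (1 + l)) :=
  block_mx 0 0 0 W.

Lemma emb_inverse (F : fieldType) l (a : F) (u : 'rV_l) (v : 'cV_l)
    (w : 'M[F]_l) : w \in unitmx ->
  let M := emb (block_mx a%:M u v w) in
  M \in unitmx /\ invmx M ord0 ord0 = schur u v w - a.
Proof.
move=> wu M; set s := schur u v w.
(* The full inverse, with [s - a] in the corner; a single product verifies it. *)
pose N : 'M[F]_(1 + (1 + l)) :=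
  block_mx (s - a)%:M (row_mx 1%:M (- (u *m invmx w)))
    (col_mx 1%:M (- (invmx w *m v))) (block_mx 0 0 0 (invmx w)).
have sE : u *m (invmx w *m v) = s%:M.
  by rewrite mulmxA -(pinvmxE wu) [LHS]mx11_scalar.
have MN : M *m N = 1%:M.
  rewrite /M /emb /N mulmx_block scalar_mx_block; congr block_mx.
  - by rewrite mul0mx mul_row_col mul0mx mul1mx addr0 add0r.
  - by rewrite mul0mx mul_row_block !mul0mx !mulmx0 !addr0 row_mx0 addr0.
  - rewrite mul_col_mx mul_block_col mul0mx mul1mx !mulmx1 !mulmxN sE mulKVmx
    //.
    by rewrite add_col_mx addrN addr0 raddfB /= addrA subrK subrr col_mx0.
  - rewrite mul_col_row mulmx_block !mul0mx !mulmx0 !mul1mx mulmxV //.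
    by rewrite add_block_mx !addr0 !add0r addNr -scalar_mx_block.
have [Mu _] := mulmx1_unit MN; split=> //.
have -> : invmx M = N by rewrite -[LHS]mulmx1 -MN mulKmx.
have -> : ord0 = lshift (1 + l) 0 :> 'I_(1 + (1 + l)) by apply: val_inj.
by rewrite block_mxEul mxE eqxx mulr1n.
Qed.

Lemma Inverse_emb p l (x y : 'M['F_p]_(1 + l)) a u v w : w \in unitmx ->
  x + y = block_mx a%:M u v w ->
  @Inverse p l.+1 (emb x) (emb0 y) = Some (schur u v w == a).
Proof.
move=> wu xy; rewrite /Inverse.
have -> : emb x + emb0 y = emb (block_mx a%:M u v w).
  by rewrite -xy /emb /emb0 add_block_mx !addr0.
by have [-> ->] := emb_inverse a u v wu; rewrite subr_eq0.
Qed.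

(** The signed sum is the probability of a correct answer minus that of a wrong one, at least 19/20
    - 1/20. *)
Lemma computes_bias (R : realType) (X Y : finType) (f : X -> Y -> option bool)
    (P : public_coin R X Y) x y b :
  computes (1 / 20) f P -> f x y = Some b ->
  9 / 10 <= (-1) ^+ (~~ b) *
    \sum_(c : coin P) weight c * (-1) ^+ ~~ run (strategy c) x y.
Proof.
move=> Pf fxy; pose good c := run (strategy (c : coin P)) x y == b.
have p_ge : 1 - 1 / 20 <= \sum_(c | good c) weight c := Pf x y b fxy.
have := weight_sum1 P; rewrite (bigID good) /= mulr_sumr [leRHS](bigID good) /=.
have -> : \sum_(c | good c)
    (-1) ^+ (~~ b) * (weight c * (-1) ^+ ~~ run (strategy c) x y) =
    \sum_(c | good c) weight c.
  by apply: eq_bigr => c /eqP ->; rewrite mulrCA -expr2 sqrr_sign mulr1.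
have -> : \sum_(c | ~~ good c)
    (-1) ^+ (~~ b) * (weight c * (-1) ^+ ~~ run (strategy c) x y) =
    - \sum_(c | ~~ good c) weight c.
  rewrite -sumrN; apply: eq_bigr => c; rewrite /good.
  by case: b {fxy p_ge good}; case: run => //= _; rewrite ?expr0 ?expr1; ring.
by move: p_ge; lra.
Qed.

(** As q^(i + 1) - 1 >= q^i, the product in [card_unitmx] is at least q to the power 0 + 1 + ... +
    k. *)
Lemma card_unitmx_ge (F : finFieldType) k :
  (#|F| ^ (2 * 'C(k.+1, 2)) <= #|(unitmx : {pred 'M[F]_k.+1})|)%N.
Proof.
have q1 := card_finNzRing_gt1 F.
rewrite card_unitmx mul2n -addnn expnD leq_mul2l; apply/orP; right.
rewrite -[in X in (X <= _)%N]bin2_sum big_mkord expn_sum; apply: leq_prod => i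
  _.
have : (0 < #|F| ^ i)%N by rewrite expn_gt0 ltnW.
by rewrite expnS; move: (#|F| ^ i)%N #|F| q1 => x q q1 x0; nia.
Qed.

(** The correlation of [psi] with the expected sign of the answer is bounded below in absolute value
    by correctness and above by the number of leaves. *)
Lemma Inverse_cost_ge (R : realType) p l
    (P : public_coin R 'M['F_p]_(l.+3) 'M['F_p]_(l.+3)) :
  prime p -> (3 <= p)%N -> computes (1 / 20) (@Inverse p l.+2) P ->
  3 / 10 * p%:R ^+ 'C(l.+1, 2) <= 2 ^+ cost P :> R.
Proof.
move=> p_pr p3 Pf.
have cardF : #|'F_p| = p by rewrite card_Fp.
pose sg c (x y : 'M['F_p]_(1 + l.+1)) : R :=
  (-1) ^+ ~~ run (strategy (c : coin P)) (emb x) (emb0 y).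
have sg1 c x y : `|sg c x y| = 1 by rewrite normrX normrN1 expr1n.
(* The expected sign when Alice holds [x] and the shared matrix is [z]. For each fixed [x] it meets
   the hypotheses of [sum_psi_le]. *)
pose B x z := \sum_c weight c * sg c x (z - x).
have B1 x z : `|B x z| <= 1.
  rewrite -(weight_sum1 P); apply: le_trans (ler_norm_sum _ _ _) _.
  apply: ler_sum => c _.
  by rewrite normrM sg1 mulr1 ger0_norm // weight_ge0.
have lower x : \sum_W psi R W * B x W <=
    - (3 / 10) * class_mass R 'F_p l.+1 0.
  apply: sum_psi_le => // [|u v w wu]; first by rewrite cardF.
  have inv a := @Inverse_emb p l.+1 x (block_mx a%:M u v w - x) a u v w wu
    (subrKC _ _).
  have b0 := computes_bias Pf (inv (schur u v w)).
  have b1 := computes_bias Pf (inv (schur u v w + 1)).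
  rewrite eqxx expr0 mul1r in b0; split=> //.
  rewrite -subr_eq0 opprD addrA subrr add0r oppr_eq0 oner_eq0 expr1 in b1.
  by rewrite /B; move: b1; set S := \sum_c _; lra.
have upper : `|\sum_(x : 'M['F_p]_(1 + l.+1)) \sum_W psi R W * B x W| <=
    2 ^+ cost P * (2 * p%:R ^+ (2 * (l.+2 * l.+2)) / p%:R ^+ 'C(l.+2, 2)).
  have -> : \sum_(x : 'M['F_p]_(1 + l.+1)) \sum_W psi R W * B x W =
      \sum_c weight c * \sum_x \sum_y 1 * 1 * (psi R (x + y) * sg c x y).
    under [RHS]eq_bigr => c _ do rewrite mulr_sumr.
    rewrite [RHS]exchange_big; apply: eq_bigr => x _ /=.
    under [RHS]eq_bigr => c _ do rewrite mulr_sumr.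
    rewrite [RHS]exchange_big (reindex_inj (addrI x)); apply: eq_bigr => y _ /=.
    rewrite mulr_sumr; apply: eq_bigr => c _.
    by rewrite [x + y - x]addrC addKr; ring.
  set bd := 2 * _ / _.
  have bd0 : 0 <= bd.
    by apply: divr_ge0; [apply: mulr_ge0 => //|]; apply: exprn_ge0; apply:
      ler0n.
  rewrite [leRHS](_ : _ = \sum_(c : coin P) weight c * (2 ^+ cost P * bd));
    last by rewrite -mulr_suml weight_sum1 mul1r.
  apply: le_trans (ler_norm_sum _ _ _) _; apply: ler_sum => c _.
  rewrite normrM ger0_norm ?weight_ge0 // ler_wpM2l ?weight_ge0 //.
  apply: (@le_trans _ _ (2 ^+ height (strategy c) * bd)).
    apply: (@protocol_sum_le R _ _ _ _ (@emb _ _) (@emb0 _ _)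
      (fun x y => psi R (x + y)) bd _ (strategy c) (fun=> 1) (fun=> 1))
      => [A' B' A'1 B'1|x|y]; rewrite ?normr1 //.
    by have := psi_bilinear_le A'1 B'1; rewrite cardF.
  rewrite ler_wpM2r // ler_weXn2l ?ler1n //.
  exact: (leq_bigmax (F := fun c => height (strategy c))).
have : \sum_(x : 'M['F_p]_(1 + l.+1)) \sum_W psi R W * B x W <=
    #|'M['F_p]_(1 + l.+1)|%:R * (- (3 / 10) * class_mass R 'F_p l.+1 0).
  by apply: sumr_le_card => x _; apply: lower.
(* The exponent collects the order of GL_(l+1), the factor p of [mass] at corank 0, and the choices
   of [u] and [v]. *)
have cm_ge : 2 * p%:R ^+ (2 * 'C(l.+1, 2) + 1 + 2 * l.+1) <=
    class_mass R 'F_p l.+1 0.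
  rewrite /class_mass /mass /qpoch big_ord0 mul1r subn0.
  rewrite ger0_norm ?exprn_ge0 // cardF 2!exprD.
  have -> : #|corank_class 'F_p l.+1 0| = #|(unitmx : {pred 'M['F_p]_l.+1})|.
    apply: eq_card => w; rewrite !inE subn_eq0 -row_full_unit /row_full.
    by rewrite eqn_leq rank_leq_row.
  have := card_unitmx_ge 'F_p l; rewrite -(ler_nat R) cardF natrX => hU.
  have c0 : 0 <= 2 * p%:R ^+ 1 * p%:R ^+ (2 * l.+1) :> R.
    by rewrite !mulr_ge0 ?exprn_ge0 ?ler0n.
  by have := ler_wpM2l c0 hU; lra.
rewrite card_mx cardF natrX => sum_le.
have p_gt0 : 0 < p%:R :> R by rewrite ltr0n prime_gt0.
have pX_gt0 i : 0 < p%:R ^+ i :> R by rewrite exprn_gt0.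
set S := \sum_x _ in sum_le upper.
have upperN : - S <= `|S| by rewrite -normrN ler_norm.
have := le_trans upperN upper; rewrite mulrA ler_pdivlMr // => upperS.
(* Comparing both bounds, all powers of p cancel except the exponent 'C(l+1, 2). *)
have eC : ((1 + l.+1) * (1 + l.+1) + (2 * 'C(l.+1, 2) + 1 + 2 * l.+1) +
  'C(l.+2, 2) =
    'C(l.+1, 2) + 2 * (l.+2 * l.+2))%N.
  have := mul_bin_diag l.+1 1; have := binS l.+1 1; rewrite !bin1 /=.
  by move: 'C(_, _) 'C(_, _) => x y; lia.
have := congr1 (fun i => p%:R ^+ i : R) eC.
rewrite [in RHS]exprD 2!exprD => eX.
rewrite -(ler_pM2r (pX_gt0 (2 * (l.+2 * l.+2))%N)).
have combine (s X E V u w t cm : R) : 0 <= X -> 0 <= V -> X * E * V = u * w ->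
    - s * V <= t * (2 * w) -> s <= X * (- (3 / 10) * cm) -> 2 * E <= cm ->
    3 / 10 * u * w <= t * w.
  clear; move=> X0 V0 XEV sV sX Ecm.
  have := ler_wpM2l (mulr_ge0 X0 V0) Ecm; have := ler_wpM2r V0 sX.
  by rewrite mulNr in sV; lra.
exact: combine (ltW (pX_gt0 _)) (ltW (pX_gt0 _)) eX upperS sum_le cm_ge.
Qed.

(** * From a bound on leaves to a bound on bits *)

Lemma Rpub_ge (R : realType) (X Y : finType) (delta : R)
    (f : X -> Y -> option bool) (b : R) :
  (forall P : public_coin R X Y, computes delta f P -> b <= (cost P)%:R) ->
  (b%:E <= Rpub delta f)%E.
Proof.
move=> cost_ge; apply: le_ereal_inf_tmp => _ [_ [P [Pf <-]] <-].
by rewrite lee_fin cost_ge.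
Qed.

(** As p^2 >= 10/3, the constant 3/10 costs two powers of p; ln 2 <= 1 then lets natural logarithms
    stand for bits. *)
Lemma le_ln_of_exp_le (R : realType) (p k c : nat) : (3 <= p)%N ->
  3 / 10 * p%:R ^+ k <= 2 ^+ c :> R -> (k%:R - 2) * ln p%:R <= c%:R :> R.
Proof.
move=> p3 hk; have p3R : 3 <= p%:R :> R by rewrite ler_nat.
have p0 : 0 < p%:R :> R by lra.
have : p%:R ^+ k <= 2 ^+ c * p%:R ^+ 2 :> R.
  have : 10 / 3 <= p%:R ^+ 2 :> R by nra.
  have : 0 < p%:R ^+ k :> R by rewrite exprn_gt0.
  by move: hk; move: (p%:R ^+ k) (p%:R ^+ 2) (2 ^+ c) => x y z; nra.
rewrite -ler_ln ?posrE ?mulr_gt0 ?exprn_gt0 // lnM ?posrE ?exprn_gt0 //.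
rewrite !lnXn // -[_ *+ k]mulr_natl -[_ *+ c]mulr_natl mulr2n.
have ln2 : ln (2 : R) <= 1.
  by have := @le_ln1Dx R 1; rewrite (_ : 1 + 1 = 2) //; apply; lra.
by have := ler_piMr (ler0n R c) ln2; lra.
Qed.

Theorem theorem5p15 (R : realType) :
  exists (c : R) (N : nat), 0 < c /\
    forall p n : nat, prime p -> (3 <= p)%N -> (N <= n.+1)%N ->
      ((c * n.+1%:R ^+ 2 * ln p%:R)%:E <= Rpub (1 / 20 : R) (@Inverse p n))%E.
Proof.
(* The matrix size is l + 3, and 'C(l+1, 2) - 2 >= (l + 3)^2 / 4 holds from l = 7 on, hence the
   threshold 10. *)
exists (1 / 4), 10%N; split; first by lra.
move=> p [|[|l]] // p_pr p3 l7; apply: Rpub_ge => P Pf.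
apply: le_trans (le_ln_of_exp_le p3 (Inverse_cost_ge p_pr p3 Pf)).
apply: ler_wpM2r; first by rewrite ln_ge0 // ler1n prime_gt0.
have : 2 * 'C(l.+1, 2)%:R = l.+1%:R * l%:R :> R.
  by have := mul_bin_diag l.+1 1; rewrite bin1 /= -!natrM => ->.
have : 7 <= l%:R :> R by rewrite ler_nat.
by rewrite -[l.+3%:R]natr1 -[l.+2%:R]natr1 -[l.+1%:R]natr1; nra.
Qed.
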